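(* Let $X$ be a compact Hausdorff space with at least three points, and suppose that $X$ contains a subspace $D$ which is compact, connected and metrizable and which has non-empty interior in $X$. Then $X$ is topologically reconstructible; that is, every topological space $Y$ with $\mathcal{D}(Y)=\mathcal{D}(X)$ is homeomorphic to $X$.
   Context: For a topological space $X$, the deck is $\mathcal{D}(X)=\{[X\setminus\{x\}] : x\in X\}$, where $[Z]$ denotes the homeomorphism class of $Z$ and $X \setminus \{x\}$ carries the subspace topology (the deck is a set, without multiplicities). $X$ is topologically reconstructible if $\mathcal{D}(X)=\mathcal{D}(Y)$ implies $X\cong Y$ for every topological space $Y$. Standing convention: all spaces considered have at least three points. *)

(* Defs.v *)
From HB Require Import structures.
From mathcomp Require Import all_boot all_order all_algebra.
From mathcomp Require Import all_classical reals topology.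

Set Implicit Arguments.
Unset Strict Implicit.
Unset Printing Implicit Defensive.

Local Open Scope classical_set_scope.

Definition homeomorphic (X Y : topologicalType) : Prop :=
  exists (f : X -> Y) (g : Y -> X),
    [/\ cancel f g, cancel g f, continuous f & continuous g].

(* A predicate rather than a [set]: the universe of [topologicalType] is too
   large for [set], as it is in [deck] below. *)
Definition homeo_class (Z : topologicalType) : topologicalType -> Prop :=
  fun W => homeomorphic Z W.

(* The topology of [set_type A] is the initial topology of the inclusion of
   [A] into [X]. *)
Definition card_at (X : topologicalType) (x : X) : topologicalType :=
  set_type (~` [set x]).

Definition deck (X : topologicalType) : (topologicalType -> Prop) -> Prop :=
  fun C => exists x : X, C = homeo_class (card_at x).

(* [topologicalType] only asks for a choice structure, which every type has
   classically, and no point: [Y] ranges over all spaces, including the empty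
   one. *)
Definition topologically_reconstructible (X : topologicalType) : Prop :=
  forall Y : topologicalType, deck X = deck Y -> homeomorphic X Y.

Definition metrizable (R : realType) (X : topologicalType) : Prop :=
  exists M : metricType R, homeomorphic X M.

Definition at_least_three_points (X : Type) : Prop :=
  exists x y z : X, [/\ x <> y, x <> z & y <> z].

(* Main.v *)
(** Call [x] an n-splitting point if [x] has a neighbourhood of the form
    [{x} + U_1 + ... + U_n] with disjoint open [U_i] all having [x] in their
    closure; for compact Hausdorff [X] this says that the card at [x] has a
    compactification by [n] points.

    Let [Y] have the deck of [X]. Then [Y] is Hausdorff and locally compact.
    If [Y] is compact, then [X] and [Y] are both the one-point compactification
    of a common card (or that card plus an isolated point). If [Y] is not
    compact, then every point of [X] is n-splitting for every [n >= 1]: when it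
    holds for [n] on [X], it holds for [n] on [Y], because a point of [Y] lies
    in another card and splitting is local; deleting a point [y] of [Y] leaves
    [n] ends at [y] and at least one at infinity, so the card at [y], which is
    any prescribed card of [X], has [n + 1] ends.

    On the other hand, in a metrizable continuum the set of 3-splitting points
    is countable: a 3-splitting point [x] is determined by a small basic
    neighbourhood [B] and the partition of the boundary of [B] that the three
    pieces induce, and by compactness there are countably many such data. But
    a nonempty open subset of a nondegenerate connected metric space is
    uncountable, since distances to a point take all small values. *)

Require Import Defs.
From HB Require Import structures.
From mathcomp Require Import all_boot all_order all_algebra finmap.
From mathcomp Require Import all_classical reals constructive_ereal topology.
From mathcomp Require Import lebesgue_measure.

Set Implicit Arguments.
Unset Strict Implicit.
Unset Printing Implicit Defensive.

Import Order.TTheory GRing.Theory Num.Theory.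

Local Open Scope classical_set_scope.

(** * Neighbourhoods in subspaces, and the Hausdorff property read off the cards *)

Lemma initial_nbhsP (T : topologicalType) (A : set T) (p : set_type A)
    (B : set (set_type A)) :
  nbhs p B <-> exists2 O : set T, open O /\ O (val p) & val @^-1` O `<=` B.
Proof.
split.
  rewrite nbhsE => -[O [[O' oO' <-] Op] OB].
  by exists O'.
case=> O [oO Op] OB; rewrite nbhsE; exists (val @^-1` O) => //.
by split => //; exists O.
Qed.

Lemma val_continuous (T : topologicalType) (A : set T) :
  continuous (val : set_type A -> T).
Proof. exact: initial_continuous. Qed.

Lemma injective_hausdorff (S T : topologicalType) (f : S -> T) :
  continuous f -> injective f -> hausdorff_space T -> hausdorff_space S.
Proof.
move=> cf injf hT p q pq; apply/injf/hT => A B Ap Bq.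
by have [s [sA sB]] := pq _ _ (cf _ _ Ap) (cf _ _ Bq); exists (f s).
Qed.

Lemma hausdorff_closed1 (T : topologicalType) (x : T) :
  hausdorff_space T -> closed [set x].
Proof. by move=> hT; exact/accessible_closed_set1/hausdorff_accessible. Qed.

Lemma third_point (T : Type) (p q : T) :
  at_least_three_points T -> exists r, r <> p /\ r <> q.
Proof.
move=> [a [b [c [ab ac bc]]]].
have [ap|ap] := pselect (a = p); have [aq|aq] := pselect (a = q);
have [bp|bp] := pselect (b = p); have [bq|bq] := pselect (b = q);
  solve [by exists a | by exists b | exists c; split; congruence | congruence].
Qed.

(** Any two points survive in the card at a third point [r]. Being T1 is proved first: it makes that
    card open in [Y], so that separation in the card is separation in [Y]. *)
Lemma hausdorff_of_cards (Y : topologicalType) : at_least_three_points Y ->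
  (forall y : Y, hausdorff_space (card_at y)) -> hausdorff_space Y.
Proof.
move=> Y3 hY.
have T1 : accessible_space Y.
  move=> p q /eqP pq; have [r [rp rq]] := third_point p q Y3.
  have rp' : (~` [set r]) p by move=> /= /esym.
  have rq' : (~` [set r]) q by move=> /= /esym.
  pose p' : card_at r := SigSub (mem_set rp').
  pose q' : card_at r := SigSub (mem_set rq').
  have p'q' : p' != q' by apply/eqP => /(congr1 val).
  have [A [[O oO <-] Op Oq]] := hausdorff_accessible (hY r) p'q'.
  by exists O; split; [|move: Op; rewrite !inE|move: Oq; rewrite !inE].
move=> p q pq; apply: contrapT => npq.
have [r [rp rq]] := third_point p q Y3.
have rp' : (~` [set r]) p by move=> /= /esym.
have rq' : (~` [set r]) q by move=> /= /esym.
pose p' : card_at r := SigSub (mem_set rp').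
pose q' : card_at r := SigSub (mem_set rq').
suff /(congr1 val) : p' = q' by [].
apply: hY => A B /initial_nbhsP [U [oU Up] UA] /initial_nbhsP [V [oV Vq] VB].
have oC : open (~` [set r]) by apply/closed_openC/accessible_closed_set1.
have [||z [[Uz zr] Vz]] := pq (U `&` ~` [set r]) V.
- by apply: open_nbhs_nbhs; split => //; exact: openI.
- exact: open_nbhs_nbhs.
by exists (SigSub (mem_set zr)); split; [exact: UA|exact: VB].
Qed.

(** * Homeomorphic cards as bijections of the whole spaces *)

(** For closed points, this is a homeomorphism of the cards at [x] and [y], extended by sending [x]
    to [y]. Total functions avoid subtypes; only continuity at [x] and at [y] is left open. *)
Definition punctured_homeo (X Y : topologicalType) (x : X) (y : Y)
    (f : X -> Y) (g : Y -> X) : Prop :=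
  [/\ cancel f g, cancel g f, f x = y,
      forall u, u <> x -> {for u, continuous f} &
      forall v, v <> y -> {for v, continuous g}].

Lemma punctured_homeo_sym (X Y : topologicalType) (x : X) (y : Y) f g :
  punctured_homeo x y f g -> punctured_homeo y x g f.
Proof. by move=> [fK gK <- cf cg]; split => //; rewrite fK. Qed.

Section card_ext.
Variables (X Y : topologicalType) (x : X) (y : Y).

Definition card_ext (h : card_at x -> card_at y) (u : X) : Y :=
  if pselect ((~` [set x]) u) is left ux then val (h (SigSub (mem_set ux)))
  else y.

Lemma card_ext_val h (u : card_at x) : card_ext h (val u) = val (h u).
Proof.
rewrite /card_ext; case: pselect => [ux|]; last by case; exact: set_valP u.
by congr (val (h _)); exact: val_inj.
Qed.

Lemma card_ext_pt h : card_ext h x = y.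
Proof. by rewrite /card_ext; case: pselect => // xx; case: (xx erefl). Qed.

Lemma card_ext_continuous h u : closed [set x] -> continuous h -> u <> x ->
  {for u, continuous (card_ext h)}.
Proof.
move=> clx ch ux; pose u' : card_at x := SigSub (mem_set (ux : (~` [set x]) u)).
move=> B; rewrite /= nbhs_simpl /= -[u]/(val u') card_ext_val => Bu.
have /initial_nbhsP [O [oO Ou] OB] : nbhs u' (h @^-1` (val @^-1` B)).
  by apply: ch; exact: val_continuous Bu.
rewrite nbhsE; exists (O `&` ~` [set x]).
  by split => //; apply: openI => //; exact: closed_openC.
move=> w [Ow wx]; pose w' : card_at x := SigSub (mem_set wx).
by change (B (card_ext h (val w'))); rewrite card_ext_val; exact: OB.
Qed.

End card_ext.

Lemma card_extK (X Y : topologicalType) (x : X) (y : Y)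
    (h : card_at x -> card_at y) k : cancel h k ->
  cancel (card_ext h) (card_ext k).
Proof.
move=> hK u; have [->|ux] := pselect (u = x); first by rewrite !card_ext_pt.
pose u' : card_at x := SigSub (mem_set (ux : (~` [set x]) u)).
by rewrite -[u]/(val u') !card_ext_val hK.
Qed.

Lemma card_homeo_punctured (X Y : topologicalType) (x : X) (y : Y) :
  closed [set x] -> closed [set y] -> homeomorphic (card_at x) (card_at y) ->
  exists f g, punctured_homeo x y f g.
Proof.
move=> clx cly [h [k [hK kH ch ck]]]; exists (card_ext h), (card_ext k).
split; [exact: card_extK|exact: card_extK|exact: card_ext_pt| |].
- by move=> u; exact: card_ext_continuous.
- by move=> u; exact: card_ext_continuous.
Qed.

Lemma homeomorphic_sym (X Y : topologicalType) :
  homeomorphic X Y -> homeomorphic Y X.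
Proof. by move=> [f [g [? ? ? ?]]]; exists g, f. Qed.

Lemma homeomorphic_refl (X : topologicalType) : homeomorphic X X.
Proof. by exists id, id; split => //; move=> x; exact: cvg_id. Qed.

Lemma deck_cards (X Y : topologicalType) : deck X = deck Y ->
  forall x : X, exists y : Y, homeomorphic (card_at x) (card_at y).
Proof.
move=> XY x; have : deck X (homeo_class (card_at x)) by exists x.
rewrite XY => -[y xy]; exists y.
by rewrite -/(homeo_class (card_at x) _) xy; exact: homeomorphic_refl.
Qed.

Lemma deck_three_points (X Y : topologicalType) : deck X = deck Y ->
  at_least_three_points X -> at_least_three_points Y.
Proof.
move=> XY [a [b [c [ab ac bc]]]].
have [y [h [k [hK _ _ _]]]] := deck_cards XY a.
have ab' : (~` [set a]) b by move=> /= /esym.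
have ac' : (~` [set a]) c by move=> /= /esym.
pose b' : card_at a := SigSub (mem_set ab').
pose c' : card_at a := SigSub (mem_set ac').
exists y, (val (h b')), (val (h c')); split.
- by move=> /esym; exact: set_valP (h b').
- by move=> /esym; exact: set_valP (h c').
- by move=> /val_inj /(can_inj hK) /(congr1 val).
Qed.

Lemma deck_hausdorff (X Y : topologicalType) : deck X = deck Y ->
  at_least_three_points X -> hausdorff_space X -> hausdorff_space Y.
Proof.
move=> XY X3 hX; apply: hausdorff_of_cards (deck_three_points XY X3) _ => y.
have [x [h [k [hK _ ch _]]]] := deck_cards (esym XY) y.
apply: (@injective_hausdorff _ X (val \o h)) => //.
- by move=> u; apply: continuous_comp; [exact: ch|exact: val_continuous].
- exact: inj_comp val_inj (can_inj hK).
Qed.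

Lemma punctured_homeo_preimage (X Y : topologicalType) (x : X) (y : Y) f g :
  closed [set x] -> punctured_homeo x y f g ->
  forall O : set Y, open O -> ~ O y -> open (f @^-1` O).
Proof.
move=> clx [fK gK fx cf cg] O oO Oy; rewrite openE => u /= Ou.
by apply: cf; [move=> ux; apply: Oy; rewrite -fx -ux|exact: open_nbhs_nbhs].
Qed.

Lemma punctured_homeo_compact (X Y : topologicalType) (x : X) (y : Y) f g :
  punctured_homeo x y f g ->
  forall K : set X, compact K -> ~ K x -> compact (f @` K).
Proof.
move=> [fK gK fx cf cg] K cK Kx; apply: continuous_compact => //.
apply: continuous_in_subspaceT => u /set_mem Ku; apply: cf => ux.
by apply: Kx; rewrite -ux.
Qed.

(** The complement of an open [O] around [y] is compact and misses [y], so [g] carries it to a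
    compact, hence closed, set missing [x]. The complement of that set is mapped into [O]. *)
Lemma punctured_homeo_continuous (X Y : topologicalType) (x : X) (y : Y) f g :
  hausdorff_space X -> compact [set: Y] -> punctured_homeo x y f g ->
  continuous f.
Proof.
move=> hX cY fg u; have [->|ux] := pselect (u = x); last first.
  by case: fg => _ _ _ + _; exact.
have [fK gK fx cf cg] := fg.
move=> B /=; rewrite nbhs_simpl /= fx nbhsE => -[O [oO Oy] OB].
have cO : compact (~` O).
  by apply: subclosed_compact cY _ => //; exact: open_closedC.
have clO := compact_closed hX
  (punctured_homeo_compact (punctured_homeo_sym fg) cO (fun nO => nO Oy)).
apply: (@filterS _ _ _ (~` (g @` (~` O)))).
  move=> v nv; apply: OB; apply: contrapT => nO; apply: nv.
  by exists (f v) => //; rewrite fK.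
apply: open_nbhs_nbhs; split; first exact: closed_openC.
by move=> [w nO /(congr1 f)]; rewrite gK fx => wy; apply: nO; rewrite wy.
Qed.

Lemma punctured_homeo_homeomorphic (X Y : topologicalType) (x : X) (y : Y) f g :
  hausdorff_space X -> compact [set: X] ->
  hausdorff_space Y -> compact [set: Y] -> punctured_homeo x y f g ->
  homeomorphic X Y.
Proof.
move=> hX cX hY cY fg; exists f, g; have [fK gK _ _ _] := fg; split => //.
- exact: punctured_homeo_continuous fg.
- exact: punctured_homeo_continuous (punctured_homeo_sym fg).
Qed.

(** * Splitting points and their passage between spaces that share a card *)

Definition splitting (T : topologicalType) (n : nat) (x : T)
    (U : 'I_n -> set T) : Prop :=
  [/\ forall i, open (U i), forall i, ~ U i x, forall i, closure (U i) x,
      forall i j z, U i z -> U j z -> i = j &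
      nbhs x (x |` \bigcup_i U i)].

Definition splits (T : topologicalType) (n : nat) (x : T) : Prop :=
  exists U : 'I_n -> set T, splitting x U.

Definition compact_nbhs_basis (T : topologicalType) (x : T) : Prop :=
  forall W, nbhs x W -> exists N, [/\ nbhs x N, compact N & N `<=` W].

(** The base case is [n = 1], since being 0-splitting means being isolated. The single piece is the
    complement of [x]. *)
Lemma splits1 (T : topologicalType) (x : T) :
  closed [set x] -> ~ open [set x] -> splits 1 x.
Proof.
move=> clx nox; exists (fun=> ~` [set x]); split => [_|_|_|i j z _ _|].
- exact: closed_openC.
- by apply.
- move=> B Bx; apply: contrapT => meet; apply: nox.
  rewrite openE => _ ->; apply: filterS Bx => z Bz /=.
  by apply: contrapT => zx; apply: meet; exists z.
- by rewrite !ord1.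
- apply: filterS filterT => z _ /=.
  by have [->|zx] := pselect (z = x); [left|right; exists ord0].
Qed.

Section transfer.
Variables (X Y : topologicalType) (x0 : X) (y0 : Y) (f : X -> Y) (g : Y -> X).
Hypotheses (clx0 : closed [set x0]) (cly0 : closed [set y0]).
Hypothesis fg : punctured_homeo x0 y0 f g.

Let g_pt v : v <> y0 -> g v <> x0.
Proof.
by case: fg => fK gK fx _ _ vy gv; apply: vy; rewrite -(gK v) gv.
Qed.

Let nbhsC1 (T : topologicalType) (z z0 : T) : closed [set z0] -> z <> z0 ->
  nbhs z (~` [set z0]).
Proof.
by move=> clz zz0; apply: open_nbhs_nbhs; split => //; exact: closed_openC.
Qed.

Lemma splits_transfer n y : y <> y0 -> splits n (g y) -> splits n y.
Proof.
move=> yy0; have [fK gK fx cf cg] := fg.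
(* Removing [x0] from the pieces keeps their preimages away from [y0], the one point where [g] may
   be discontinuous. *)
move=> [U [oU Ux clU Ueq Unb]]; exists (fun i => g @^-1` (U i `&` ~` [set x0])).
split.
- move=> i; apply: (punctured_homeo_preimage cly0 (punctured_homeo_sym fg)).
    by apply: openI => //; exact: closed_openC.
  by case=> _; exact.
- by move=> i [] /Ux.
- move=> i B By; have gB : nbhs (g y) (f @^-1` B).
    by apply: cf; [exact: g_pt|rewrite gK].
  have [u [Uu [Bu ux]]] := clU i _ (filterI gB (nbhsC1 clx0 (g_pt yy0))).
  by exists (f u); split => //; rewrite /= fK.
- by move=> i j z [Ui _] [Uj _]; exact: Ueq Ui Uj.
- have : nbhs y (g @^-1` ((g y |` \bigcup_i U i) `&` ~` [set x0])).
    by apply: cg => //; apply: filterI => //; apply: nbhsC1 => //; exact: g_pt.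
  apply: filterS => z [[gz|[i _ Uz]] zx]; last by right; exists i.
  by left; rewrite /= -(gK z) gz gK.
Qed.

Lemma compact_nbhs_basis_transfer y : y <> y0 ->
  compact_nbhs_basis (g y) -> compact_nbhs_basis y.
Proof.
move=> yy0; have [fK gK fx cf cg] := fg.
move=> cN W Wy; have gW : nbhs (g y) (f @^-1` W).
  by apply: cf; [exact: g_pt|rewrite gK].
have [N [Ny cptN NW]] := cN _ (filterI gW (nbhsC1 clx0 (g_pt yy0))).
exists (f @` N); split.
- have gN : nbhs y (g @^-1` N) by exact: cg Ny.
  by apply: filterS gN => z Nz; exists (g z); rewrite ?gK.
- by apply: (punctured_homeo_compact fg) => // /NW [_]; apply.
- by move=> _ [u /NW [Wu _] <-].
Qed.

End transfer.

Lemma compact_hausdorff_nbhs_basis (X : topologicalType) (x : X) :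
  hausdorff_space X -> compact [set: X] -> compact_nbhs_basis x.
Proof.
move=> hX cX W Wx.
have [A Ax AW] := compact_regular hX cX filterT Wx.
exists (closure A); split => //.
- by apply: filterS Ax; exact: subset_closure.
- by apply: subclosed_compact cX _ => //; exact: closed_closure.
Qed.

(* The extra piece is the trace of a neighbourhood of infinity in [Y]. *)
Lemma splits_succ (X Y : topologicalType) (x : X) (y : Y) f g n :
  hausdorff_space X -> compact [set: X] ->
  hausdorff_space Y -> ~ compact [set: Y] -> compact_nbhs_basis y ->
  punctured_homeo x y f g -> splits n y -> splits n.+1 x.
Proof.
move=> hX cX hY ncY cNy fg [U [oU Uy clU Ueq Unb]].
have [fK gK fx cf cg] := fg.
have clx : closed [set x] by exact: hausdorff_closed1.
have [N [Ny cN NU]] := cNy _ Unb.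
(* Index [ord_max] carries the piece at infinity; the others are cut down to the interior of [N], to
   stay open and disjoint from it. *)
pose V (i : 'I_n.+1) :=
  if unlift ord_max i is Some j then U j `&` N° else ~` N.
have oV i : open (V i).
  rewrite /V; case: unlift => [j|].
    by apply: openI => //; exact: open_interior.
  by apply: closed_openC; exact: compact_closed.
have Vy i : ~ V i y.
  by rewrite /V; case: unlift => [j [/Uy]|] //; apply; exact: nbhs_singleton.
have Veq i j z : V i z -> V j z -> i = j.
  rewrite /V; case: (unliftP ord_max i) => [i' ->|->];
    case: (unliftP ord_max j) => [j' ->|->] //.
  - by move=> [Ui _] [Uj _]; rewrite (Ueq _ _ _ Ui Uj).
  - by move=> [_ /interior_subset].
  - by move=> nN [_ /interior_subset].
(* The pieces at [y] accumulate there, and the outer one inside [K] would make [Y] compact. This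
   puts [x] in the closure of every piece, because open neighbourhoods of [x] have compact
   complements. *)
have Vnc i K : compact K -> ~ K y -> ~ V i `<=` K.
  move=> cK Ky; rewrite /V; case: unlift => [j|] VK.
    have nK : nbhs y (~` K).
      apply: open_nbhs_nbhs; split => //; apply: closed_openC.
      exact: compact_closed.
    have [z [Uz [Nz nKz]]] := clU j _ (filterI (nbhs_interior Ny) nK).
    by apply: nKz; exact: VK.
  apply: ncY; suff -> : [set: Y] = N `|` K by exact: compactU.
  rewrite eqEsubset; split => // z _.
  by have [Nz|nNz] := pselect (N z); [left|right; exact: VK].
(* Besides [y], only boundary points of [N] can be missed. The boundary is compact and avoids [y],
   so its image under [g] is closed and avoids [x]. *)
have Vcov z : z <> y -> ~ (N `&` ~` N°) z -> exists i, V i z.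
  move=> zy nK; have [Nz|nNz] := pselect (N z); last first.
    by exists ord_max; rewrite /V unlift_none.
  have [zy'|[i _ Uz]] := NU _ Nz; first by case: zy.
  exists (lift ord_max i); rewrite /V liftK; split => //.
  by apply: contrapT => nNz; apply: nK.
exists (fun i => f @^-1` V i); split.
- by move=> i; exact: (punctured_homeo_preimage clx fg).
- by move=> i /=; rewrite fx.
- move=> i B; rewrite nbhsE => -[O [oO Ox] OB].
  apply: contrapT => meet.
  have cO : compact (~` O).
    by apply: subclosed_compact cX _ => //; exact: open_closedC.
  apply: (Vnc i (f @` (~` O))).
  + exact: (punctured_homeo_compact fg).
  + by move=> [u nO]; rewrite -fx => /(can_inj fK) ux; apply: nO; rewrite ux.
  + move=> z Vz; exists (g z); rewrite ?gK// => Oz; apply: meet.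
    by exists (g z); split; [rewrite /= gK|exact: OB].
- by move=> i j z; exact: Veq.
- have cK : compact (N `&` ~` N°).
    by apply: compact_closedI => //; exact/open_closedC/open_interior.
  have nKy : ~ (N `&` ~` N°) y by case=> _; apply.
  have clK := compact_closed hX
    (punctured_homeo_compact (punctured_homeo_sym fg) cK nKy).
  apply: (@filterS _ _ _ (~` (g @` (N `&` ~` N°)))).
    move=> u nu; have [->|ux] := pselect (u = x); first by left.
    right; have [||i Vi] := Vcov (f u); last by exists i.
    + by rewrite -fx => /(can_inj fK).
    + by move=> Ku; apply: nu; exists (f u).
  apply: open_nbhs_nbhs; split; first exact: closed_openC.
  move=> [v Kv /(congr1 f)]; rewrite gK fx => vy.
  by apply: nKy; rewrite -vy.
Qed.

(** * Consequences of a noncompact space with the same deck *)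

Section noncompact_partner.
Variables X Y : topologicalType.
Hypotheses (XY : deck X = deck Y) (X3 : at_least_three_points X).
Hypotheses (hX : hausdorff_space X) (cX : compact [set: X]).
Hypothesis ncY : ~ compact [set: Y].

Let hY : hausdorff_space Y := deck_hausdorff XY X3 hX.

Let punctured_of_X x : exists (y : Y) (f : X -> Y) (g : Y -> X),
  punctured_homeo x y f g.
Proof.
have [y xy] := deck_cards XY x; exists y.
by apply: card_homeo_punctured => //; exact: hausdorff_closed1.
Qed.

Let punctured_of_Y y : exists (x : X) (f : X -> Y) (g : Y -> X),
  punctured_homeo x y f g.
Proof.
have [x yx] := deck_cards (esym XY) y; exists x.
by apply: card_homeo_punctured; [exact: hausdorff_closed1..|exact: homeomorphic_sym].
Qed.

Let punctured_avoiding (y : Y) :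
  exists (x0 : X) (y0 : Y) (f : X -> Y) (g : Y -> X),
    y <> y0 /\ punctured_homeo x0 y0 f g.
Proof.
have [y0 [/nesym yy0 _]] := third_point y y (deck_three_points XY X3).
by have [x0 [f [g fg]]] := punctured_of_Y y0; exists x0, y0, f, g.
Qed.

(** Two cards of [Y] are used: one at some [y0] other than [y] brings [n] pieces from [X] to [y],
    and then the card at [y], which is also the card at [x], gains one more piece at infinity. *)
Lemma partner_splits_all n : (forall x : X, splits n x) ->
  forall x : X, splits n.+1 x.
Proof.
move=> spX x; have [y [f [g fg]]] := punctured_of_X x.
have [x0 [y0 [f0 [g0 [yy0 fg0]]]]] := punctured_avoiding y.
apply: (splits_succ hX cX hY ncY _ fg).
- apply: (compact_nbhs_basis_transfer _ fg0) => //.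
    exact: hausdorff_closed1.
  exact: compact_hausdorff_nbhs_basis.
- by apply: (splits_transfer _ _ fg0) => //; exact: hausdorff_closed1.
Qed.

(** If [x] were isolated, its card would be compact, and [Y] is a copy of that card with one point
    added. *)
Lemma partner_splits1 (x : X) : splits 1 x.
Proof.
apply: splits1; [exact: hausdorff_closed1|move=> ox; apply: ncY].
have [y [f [g fg]]] := punctured_of_X x; have [fK gK fx _ _] := fg.
have -> : [set: Y] = y |` (f @` (~` [set x])).
  rewrite eqEsubset; split => // z _.
  have [->|zy] := pselect (z = y); [by left|right].
  by exists (g z); rewrite ?gK// => gz; apply: zy; rewrite -fx -gz gK.
apply: compactU; first exact: compact_set1.
apply: (punctured_homeo_compact fg); last exact.
by apply: subclosed_compact cX _ => //; exact: open_closedC.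
Qed.

Lemma partner_splits n (x : X) : splits n.+1 x.
Proof.
by elim: n x => [|n IHn]; [exact: partner_splits1|exact: partner_splits_all].
Qed.

End noncompact_partner.

(** One point that fails to split rules out noncompact partners; between compact Hausdorff spaces,
    sharing the card at [x] is enough. *)
Lemma reconstructible_of_nonsplitting (X : topologicalType) (x : X) n :
  at_least_three_points X -> hausdorff_space X -> compact [set: X] ->
  ~ splits n.+1 x -> topologically_reconstructible X.
Proof.
move=> X3 hX cX nsp Y XY.
have hY := deck_hausdorff XY X3 hX.
have cY : compact [set: Y].
  by apply: contrapT => ncY; apply: nsp; exact: (partner_splits XY).
have [y xy] := deck_cards XY x.
have [||f [g fg]] := card_homeo_punctured _ _ xy; [exact: hausdorff_closed1..|].
exact: punctured_homeo_homeomorphic fg.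
Qed.

(** * Countability of the 3-splitting points of a second countable continuum *)

Lemma second_countable_seq (T : topologicalType) : @second_countable T ->
  exists b : nat -> set T, (forall n, open (b n)) /\
    forall x W, nbhs x W -> exists2 n, b n x & b n `<=` W.
Proof.
move=> [B /countable_injP [e inje] [oB basB]].
have be O : B O -> \bigcup_(X in [set X | B X /\ e X = e O]) X = O.
  move=> BO; rewrite eqEsubset; split => [z [X [BX /inje]]|z Oz].
    by rewrite !inE => /(_ BX BO) ->.
  by exists O.
(* The union has at most one member, as [e] is injective on [B]; indices that are not values of [e]
   give the empty set. *)
exists (fun n => \bigcup_(X in [set X | B X /\ e X = n]) X); split.
  by move=> n; apply: bigcup_open => X [/oB].
move=> x W /basB [O [BO Ox] OW]; exists (e O); first by rewrite be.
by rewrite be.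
Qed.

(** When [A] is open and misses [x], such a [V] is closed, and [x] is the only point at which it may
    fail to be open. *)
Definition pendant (T : topologicalType) (x : T) (A V : set T) : Prop :=
  [/\ V x, V `<=` x |` A, closed V & exists2 O, open O & V = O `&` (x |` A)].

(* If [V] is pendant and [V'] is a smaller pendant missing [z \in V], then
   [V `\` V'] is a proper nonempty clopen set. *)
Lemma no_small_pendant (T : topologicalType) (x : T) (A : set T) :
  connected [set: T] -> accessible_space T ->
  open A -> ~ A x -> closure A x ->
  exists2 G, nbhs x G & forall V, pendant x A V -> ~ V `<=` G.
Proof.
move=> conT T1 oA Ax clA.
have [[V pV]|noV] := pselect (exists V, pendant x A V); last first.
  by exists setT; [exact: filterT|move=> V pV; case: noV; exists V].
have [Vx VA clV [O oO VE]] := pV.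
have Ox : O x by move: Vx; rewrite VE => -[].
have [z [Az Oz]] : A `&` O !=set0 by apply: clA; exact: open_nbhs_nbhs.
have xz : x <> z by move=> xz; apply: Ax; rewrite xz.
exists (~` [set z]).
  apply: open_nbhs_nbhs; split => //.
  by apply: closed_openC; exact: accessible_closed_set1.
move=> V' [V'x V'A clV' [O' oO' V'E]] V'z.
(* Two formulas for the same difference: the first shows that it is open, the second that it is
   closed. *)
have VV'E : V `\` V' = (O `&` A) `&` ~` V'.
  rewrite VE eqEsubset; split => w.
    by move=> [[Ow [wx|Aw]] nw]; [case: nw; rewrite wx|].
  by move=> [[Ow Aw] nw]; split => //; split => //; right.
have VV'C : V `\` V' = V `&` ~` O'.
  rewrite eqEsubset; split => w [Vw nw]; split => //.
    by move=> O'w; apply: nw; rewrite V'E; split => //; exact: VA.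
  by rewrite V'E => -[].
have : V `\` V' = [set: T].
  apply: conT.
  - exists z; split; first by rewrite VE; split => //; right.
    by move/V'z; apply.
  - exists (V `\` V'); last by rewrite setTI.
    by rewrite VV'E; apply: openI; [exact: openI|exact: closed_openC].
  - exists (V `\` V'); last by rewrite setTI.
    by rewrite VV'C; apply: closedI => //; exact: open_closedC.
by move/seteqP => [_ /(_ x I)] [].
Qed.

(** This is where three pieces are used: [splitting3_unique] has two indices to avoid. *)
Lemma ord3_third (a j : 'I_3) : exists k : 'I_3, k <> a /\ k <> j.
Proof.
have /card_gt0P [k] : 0 < #|~: [set a; j]%SET|.
  by rewrite cardsCs finset.setCK card_ord cards2; case: eqP.
by rewrite !inE negb_or => /andP [/eqP ka /eqP kj]; exists k.
Qed.

(* With [x] in the [j]-th piece at [x'] and [x'] in the [a]-th piece at [x],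
   any third index [k] yields the pendant [{x} + (U k - U' k)] inside [B]. *)
Lemma splitting3_unique (T : topologicalType) (B : set T) (x x' : T)
    (U U' : 'I_3 -> set T) :
  open B -> splitting x U -> splitting x' U' -> B x -> B x' ->
  closure B `<=` x |` \bigcup_i U i -> closure B `<=` x' |` \bigcup_i U' i ->
  (forall i, (closure B `\` B) `&` U i `<=` U' i) ->
  (forall i V, pendant x (U i) V -> ~ V `<=` B) -> x = x'.
Proof.
move=> oB [oU Ux clU Ueq _] [oU' Ux' clU' Ueq' _] Bx Bx' BU BU' bdU noV.
apply: contrapT => xx'.
have [|[a _ Uax']] := BU x' (subset_closure Bx'); first by move=> /esym.
have [//|[j _ U'jx]] := BU' x (subset_closure Bx).
have [k [ka kj]] := ord3_third a j.
have U'kx : ~ U' k x by move=> U'kx; apply: kj; exact: Ueq' U'kx U'jx.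
have Ukx' : ~ U k x' by move=> Ukx'; apply: ka; exact: Ueq Ukx' Uax'.
pose V := x |` ((U k `&` B) `\` U' k).
apply: (noV k V); last by move=> z [->|[[_ Bz] _]].
split; [by left|by move=> z [->|[[Ukz _] _]]; [left|right]| |].
(* Closedness: inside [closure B], avoiding the other pieces leaves [x] and [U k], and the boundary
   points of [B] in [U k] belong to [U' k]. *)
- have -> : V = closure B `&` ~` (\bigcup_(l in [set~ k]) U l) `&` ~` U' k.
    rewrite eqEsubset; split => z.
      move=> [->|[[Ukz Bz] nz]].
        by split => //; split; [exact: subset_closure|move=> [l _ /Ux]].
      split => //; split; first exact: subset_closure.
      by move=> [l lk Ulz]; apply: lk; exact: Ueq Ulz Ukz.
    move=> [[Bz nz] nU'z].
    have [zx|[i _ Uiz]] := BU z Bz; [by left|right; split => //].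
    have ik : i = k by apply: contrapT => ik; apply: nz; exists i.
    rewrite -ik; split => //; apply: contrapT => nBz; apply: nU'z.
    by rewrite -ik; exact: bdU.
  apply: closedI; last exact: open_closedC.
  apply: closedI; first exact: closed_closure.
  by apply: open_closedC; apply: bigcup_open.
(* Relative openness: a point of [B] in [U k] or equal to [x] is not [x'], so it avoids [U' k]
   exactly when it lies in another piece at [x']. *)
- exists (B `&` \bigcup_(l in [set~ k]) U' l).
    by apply: openI => //; exact: bigcup_open.
  rewrite eqEsubset; split => z.
    move=> [->|[[Ukz Bz] nz]].
      by split; [split => //; exists j => //= /esym|left].
    split; last by right.
    split => //; have [zx'|[i _ U'iz]] := BU' z (subset_closure Bz).
      by case: Ukx'; rewrite -zx'.
    by exists i => // ik; apply: nz; rewrite -ik.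
  move=> [[Bz [l lk U'lz]] [->|Ukz]]; [by left|right; split => //].
  by move=> U'kz; apply: lk; exact: Ueq' U'lz U'kz.
Qed.

Lemma compact_base_union (T : ptopologicalType) (b : nat -> set T) :
  (forall n, open (b n)) ->
  (forall x W, nbhs x W -> exists2 n, b n x & b n `<=` W) ->
  forall K O : set T, compact K -> open O -> K `<=` O ->
  exists s : {fset nat}, K `<=` \bigcup_(n in [set` s]) b n /\
    \bigcup_(n in [set` s]) b n `<=` O.
Proof.
move=> ob basb K O; rewrite compact_cover => cK oO KO.
have [||s sO Ks] := cK nat [set n | b n `<=` O] b.
- by move=> n _; exact: ob.
- move=> x /KO Ox; have [|n bx bO] := basb x O; last by exists n.
  exact: open_nbhs_nbhs.
by exists s; split => // z [n /sO + bz]; rewrite inE; exact.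
Qed.

Lemma splits3_countable (T : ptopologicalType) :
  hausdorff_space T -> compact [set: T] -> @second_countable T ->
  connected [set: T] -> countable [set x : T | splits 3 x].
Proof.
move=> hT cT /second_countable_seq [b [ob basb]] conT.
have T1 := hausdorff_accessible hT.
pose Q (s : {ffun 'I_3 -> {fset nat}}) i := \bigcup_(n in [set` s i]) b n.
(* The finite sets of indices record the partition of the boundary of a basic neighbourhood. Codes
   range over a countable type, and a code determines its point by [splitting3_unique]. *)
pose codes (x : T) (c : nat * {ffun 'I_3 -> {fset nat}}) :=
  exists U, [/\ splitting x U, b c.1 x, closure (b c.1) `<=` x |` \bigcup_i U i,
    (forall i V, pendant x (U i) V -> ~ V `<=` b c.1) &
    forall i, (closure (b c.1) `\` b c.1) `&` U i =
              (closure (b c.1) `\` b c.1) `&` Q c.2 i].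
have codes_ex x : splits 3 x -> exists c, codes x c.
  move=> [U spU]; have [oU Ux clU Ueq Unb] := spU.
  have /choice [G GU] : forall i, exists G, nbhs x G /\
      forall V, pendant x (U i) V -> ~ V `<=` G.
    by move=> i; have [G] := no_small_pendant conT T1 (oU i) (Ux i) (clU i);
      exists G.
  have nbG : nbhs x [set z | forall i, G i z].
    by apply: filter_forall => i; have [] := GU i.
  have [C Cx CW] := compact_regular hT cT filterT (filterI Unb nbG).
  have [n bx bC] := basb x C Cx.
  have bW : closure (b n) `<=`
      (x |` \bigcup_i U i) `&` [set z | forall i, G i z].
    by apply: subset_trans CW; exact: closure_subset.
  have /choice [s sP] : forall i, exists s : {fset nat},
      (closure (b n) `\` b n) `&` U i `<=` \bigcup_(m in [set` s]) b m /\
      \bigcup_(m in [set` s]) b m `<=` U i.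
    move=> i; apply: compact_base_union => //.
    (* The trace of [U i] on the boundary is closed, hence compact, because there the other pieces
       form its complement. *)
    suff -> : (closure (b n) `\` b n) `&` U i =
        closure (b n) `&` ~` (b n `|` \bigcup_(l in [set~ i]) U l).
      apply: subclosed_compact cT _ => //.
      apply: closedI; first exact: closed_closure.
      by apply: open_closedC; apply: openU => //; exact: bigcup_open.
    rewrite eqEsubset; split => z.
      move=> [[clz nz] Uiz]; split => // -[//|[l li Ulz]].
      by apply: li; exact: Ueq Ulz Uiz.
    move=> [clz nz]; have [[zx|[l _ Ulz]] _] := bW z clz.
      by case: nz; left; rewrite zx.
    split; first by split => // bz; apply: nz; left.
    suff <- : l = i by [].
    by apply: contrapT => li; apply: nz; right; exists l.
  exists (n, [ffun i => s i]), U; split => //=.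
  - by move=> z /bW [].
  - move=> i V pV Vb; have [_ /(_ V pV)] := GU i; apply.
    by move=> z /Vb /subset_closure /bW [_ /(_ i)].
  - move=> i; rewrite /Q ffunE; have [s1 s2] := sP i.
    rewrite eqEsubset; split => z [zn Uz]; split => //.
      exact: s1.
    exact: s2.
have codes_inj x x' c : codes x c -> codes x' c -> x = x'.
  move=> [U [spU bx bU noV UQ]] [U' [spU' bx' bU' noV' UQ']].
  apply: (splitting3_unique (ob c.1) spU spU') => // i z.
  by rewrite UQ -UQ' => -[].
have /choice [c cP] : forall x, exists c, splits 3 x -> codes x c.
  move=> x; have [/codes_ex [c cx]|nx] := pselect (splits 3 x).
    by exists c.
  (* A dummy code for the points that do not split. *)
  by exists (0%N, [ffun=> fset0]).
apply/countable_injP; exists (fun x => choice.pickle (c x)) => x x'.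
rewrite !inE => /= sx sx' /(pcan_inj choice.pickleK) cc.
by apply: (codes_inj _ _ (c x)); [exact: cP|rewrite cc; exact: cP].
Qed.

(** The base point is a parameter because [splits3_countable] is about pointed spaces, whereas [M]
    may be empty. *)
Definition pointed_at (R : realType) (M : metricType R) (p : M) : Type := M.
HB.instance Definition _ (R : realType) (M : metricType R) (p : M) :=
  Metric.copy (@pointed_at R M p) M.
HB.instance Definition _ (R : realType) (M : metricType R) (p : M) :=
  isPointed.Build (@pointed_at R M p) p.

Lemma metric_splits3_countable (R : realType) (M : metricType R) :
  compact [set: M] -> connected [set: M] -> countable [set m : M | splits 3 m].
Proof.
move=> cM conM; have [[p _]|noM] := pselect (exists p : M, True).
  apply: (@splits3_countable (@pointed_at R M p)) => //.
    exact: (@metric_hausdorff _ M).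
  exact: compact_second_countable.
suff -> : [set m : M | splits 3 m] = set0 by exact: countable0.
by rewrite -subset0 => m; case: noM; exists m.
Qed.

(** * Uncountable neighbourhoods in connected metric spaces *)

(** Small spheres around [p] are nonempty, since otherwise an open ball would be clopen. So the
    distance to [p] takes on [A] every value of an interval. *)
Lemma nbhs_uncountable (R : realType) (M : metricType R) (p q : M) (A : set M) :
  connected [set: M] -> p <> q -> nbhs p A -> ~ countable A.
Proof.
move=> conM pq /nbhs_ballP [r /= r0 rA] cA.
(* The bound [r] keeps the spheres inside [A], and [mdist p q] keeps [q] outside the balls. *)
pose d := Num.min r (mdist p q).
have d0 : (0 < d)%R by rewrite lt_min r0 mdist_gt0; exact/eqP.
have sphere s : (0 < s)%R -> (s < d)%R -> exists2 z, A z & mdist p z = s.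
  move=> s0; rewrite lt_min => /andP [sr spq].
  suff [z zs] : exists z, mdist p z = s.
    by exists z => //; apply: rA; rewrite ballEmdist /= zs.
  apply: contrapT => nosphere.
  have olt : open [set z | (mdist p z < s)%R].
    rewrite openE => z /= zs; apply/nbhs_ballP.
    exists (s - mdist p z)%R => /=; first by rewrite subr_gt0.
    move=> w; rewrite ballEmdist /= ltrBrDl => zw.
    exact: le_lt_trans (metric_triangle p z w) zw.
  have ogt : open [set z | (s < mdist p z)%R].
    rewrite openE => z /= zs; apply/nbhs_ballP.
    exists (mdist p z - s)%R => /=; first by rewrite subr_gt0.
    move=> w; rewrite ballEmdist /= ltrBrDl -ltrBrDr => zw.
    apply: lt_le_trans zw _; rewrite lerBlDr (metric_sym z w).
    exact: metric_triangle.
  have : [set z | (mdist p z < s)%R] = [set: M].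
    apply: conM.
    - by exists p; rewrite /= mdistxx.
    - by eexists; [exact: olt|rewrite setTI].
    - exists (~` [set z | (s < mdist p z)%R]); first exact: open_closedC.
      rewrite setTI eqEsubset; split => z /=.
        by move=> /ltW; rewrite leNgt => /negP.
      move=> /negP; rewrite -leNgt le_eqVlt => /orP [/eqP zs|//].
      by case: nosphere; exists z.
  by move/seteqP => [_ /(_ q I)] /=; rewrite ltNge (ltW spq).
have cI : countable `]0%R, d[%classic.
  apply: (@sub_countable _ _ _ A) => //.
  apply: card_le_trans (card_image_le (mdist p) A); apply: subset_card_le.
  move=> s /=; rewrite in_itv /= => /andP [s0 sd].
  by have [z Az <-] := sphere s s0 sd; exists z.
(* A countable set has measure zero, but the interval has measure [d]. *)
have := countable_lebesgue_measure0 cI.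
rewrite lebesgue_measure_itv /= lte_fin d0 oppr0 adde0 => -[d00].
by move: d0; rewrite d00 ltxx.
Qed.

(** * From the subspace [D] to its metric model, and the conclusion *)

Lemma set_type_compact (X : topologicalType) (D : set X) :
  compact D -> compact [set: set_type D].
Proof.
move=> cD F FF _.
have [|x [Dx clx]] := cD (val @ F) _.
  change (F (val @^-1` D)).
  by apply: filterS filterT => u _; exact: set_valP.
pose x' : set_type D := SigSub (mem_set Dx).
exists x'; split => // A B FA /initial_nbhsP [O [oO Ox] OB].
have [||z [[u Au uz] Oz]] := clx (val @` A) O.
- change (F (val @^-1` (val @` A))).
  by apply: filterS FA => u Au; exists u.
- exact: open_nbhs_nbhs.
by exists u; split => //; apply: OB; rewrite /= uz.
Qed.

Lemma set_type_connected (X : topologicalType) (D : set X) :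
  connected D -> connected [set: set_type D].
Proof.
move=> conD B [u Bu] [C [O oO OC] BC] [C' clC' BC'].
move: BC BC'; rewrite !setTI => BC BC'.
have [O' oO' O'C'] : open (~` C') by exact: closed_openC.
have BD : val @` B = D.
  apply: conD.
  - by exists (val u), u.
  - exists O => //; rewrite eqEsubset; split => z.
      by move=> [v Bv <-]; split; [exact: set_valP|move: Bv; rewrite BC -OC].
    move=> [Dz Oz]; exists (SigSub (mem_set Dz)) => //.
    by rewrite BC -OC.
  - exists (~` O'); first exact: open_closedC.
    rewrite eqEsubset; split => z.
      move=> [v Bv <-]; split; first exact: set_valP.
      move=> O'v; suff : (~` C') v by apply; rewrite -BC'.
      by rewrite -O'C'.
    move=> [Dz O'z]; exists (SigSub (mem_set Dz)) => //.
    rewrite BC'; apply: contrapT => nC'; apply: O'z.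
    suff : (val @^-1` O') (SigSub (mem_set Dz)) by [].
    by rewrite O'C'.
rewrite eqEsubset; split => // v _.
have : (val @` B) (val v) by rewrite BD; exact: set_valP.
by case=> w Bw /val_inj <-.
Qed.

(** The pieces are pulled back along [M -> D -> X]. Since the point is interior to [D],
    neighbourhoods in [D] are neighbourhoods in [X], so they still meet every piece. *)
Lemma splits_interior (X M : topologicalType) (D : set X)
    (h : set_type D -> M) (k : M -> set_type D) n (m : M) :
  cancel h k -> cancel k h -> continuous h -> continuous k ->
  D° (val (k m)) -> splits n (val (k m)) -> splits n m.
Proof.
move=> hK kK ch ck Dm [U [oU Ux clU Ueq Unb]].
have cvk : continuous (val \o k).
  by move=> z; apply: continuous_comp; [exact: ck|exact: val_continuous].
exists (fun i => (val \o k) @^-1` U i); split.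
- by move=> i; exact: ((continuousP _).1 cvk).
- by move=> i; exact: Ux.
- move=> i B Bm.
  have /initial_nbhsP [O [oO Om] OB] : nbhs (k m) (h @^-1` B).
    by apply: ch; rewrite kK.
  have OD : nbhs (val (k m)) (O `&` D).
    by apply: filterI => //; exact: open_nbhs_nbhs.
  have [z [Uz [Oz Dz]]] := clU i _ OD.
  exists (h (SigSub (mem_set Dz))); split; first by rewrite /= hK.
  exact: OB.
- by move=> i j z; exact: Ueq.
- have : nbhs m ((val \o k) @^-1` (val (k m) |` \bigcup_i U i)) by exact: cvk.
  apply: filterS => z [/val_inj/(can_inj kK) ->|[i _ Uz]]; first by left.
  by right; exists i.
Qed.

Lemma exists_nonsplitting (R : realType) (X : topologicalType) (D : set X) :
  compact D -> connected D -> metrizable R (set_type D) ->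
  D° !=set0 -> exists x : X, ~ splits 3 x.
Proof.
move=> cD conD [M [h [k [hK kK ch ck]]]] [x0 Dx0]; apply: contrapT => allsp.
have sp (x : X) : splits 3 x by apply: contrapT => nsp; apply: allsp; exists x.
have imh : h @` [set: set_type D] = [set: M].
  by rewrite eqEsubset; split => // m _; exists (k m).
have cM : compact [set: M].
  rewrite -imh; apply: continuous_compact; last exact: set_type_compact.
  exact: continuous_subspaceT.
have conM : connected [set: M].
  rewrite -imh; apply: connected_continuous_connected.
    exact: set_type_connected.
  exact: continuous_subspaceT.
have spM (m : M) : D° (val (k m)) -> splits 3 m.
  by move=> Dm; exact: splits_interior hK kK ch ck Dm (sp _).
pose p := h (SigSub (mem_set (interior_subset Dx0))).
have Dp : D° (val (k p)) by rewrite /p hK.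
(* The splitting itself provides a second point of [M]: its pieces are nonempty and miss [p]. *)
have [U [_ Up clU _ _]] := spM p Dp.
have [q [Uq _]] := clU ord0 _ filterT.
have pq : p <> q by move=> pq; apply: (Up ord0); rewrite pq.
apply: (@nbhs_uncountable R M p q [set m | D° (val (k m))]) => //.
  have cvk : {for p, continuous (val \o k)}.
    by apply: continuous_comp; [exact: ck|exact: val_continuous].
  by apply: cvk; apply: nbhs_interior.
apply: sub_countable (metric_splits3_countable cM conM).
exact: subset_card_le.
Qed.

Theorem corollary4p13 (R : realType) (X : topologicalType) (D : set X)
    (X3 : at_least_three_points X)
    (cptX : compact [set: X]) (hausX : hausdorff_space X)
    (cptD : compact D) (conD : connected D)
    (metD : metrizable R (set_type D)) (intD : interior D !=set0) :
  topologically_reconstructible X.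
Proof.
have [x nspx] := exists_nonsplitting cptD conD metD intD.
exact: reconstructible_of_nonsplitting nspx.
Qed.
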